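(* Let $Z$ be a fat point scheme in $\mathbb{P}^1\times\mathbb{P}^1$ and let $\alpha_Z$, $\beta_Z$ be as defined below. Then: (i) for every fixed $j\in\mathbb{N}$ and every $i\ge|\alpha_Z|-1$ (note $|\alpha_Z|=l_1+\dots+l_r$), $$H_Z(i,j)=\sum_{k=1}^{j+1}\#\{\text{entries of }\alpha_Z\text{ that are }\ge k\};$$ (ii) for every fixed $i\in\mathbb{N}$ and every $j\ge|\beta_Z|-1$ (note $|\beta_Z|=l'_1+\dots+l'_t$), $$H_Z(i,j)=\sum_{k=1}^{i+1}\#\{\text{entries of }\beta_Z\text{ that are }\ge k\}.$$ Here entries are counted with multiplicity.
   Context: $\mathbf{k}$ algebraically closed, $R=\mathbf{k}[x_0,x_1,y_0,y_1]$ bigraded with $\deg x_i=(1,0)$, $\deg y_i=(0,1)$; a point $[a_0:a_1]\times[b_0:b_1]$ has ideal $(a_1x_0-a_0x_1,b_1y_0-b_0y_1)$; a fat point scheme $Z=\{(P_1;m_1),\dots,(P_s;m_s)\}$ (distinct points, positive multiplicities) has ideal $I_Z=\bigcap\wp_{P_i}^{m_i}$ and Hilbert function $H_Z(i,j)=\dim_{\mathbf{k}}(R/I_Z)_{(i,j)}$. Let $\pi_1,\pi_2$ be the two projections $\mathbb{P}^1\times\mathbb{P}^1\to\mathbb{P}^1$, $\pi_1(\mathrm{Supp}\,Z)=\{R_1,\dots,R_r\}$ and $\pi_2(\mathrm{Supp}\,Z)=\{Q_1,\dots,Q_t\}$ (distinct), and let $m_{ij}$ be the multiplicity of $R_i\times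 Q_j$ in $Z$ ($m_{ij}=0$ if this point is not in the support). Write $(n)_+=\max\{0,n\}$. For $i=1,\dots,r$ let $l_i=\max_j m_{ij}$ and $a_{i,k}=\sum_{j=1}^t(m_{ij}-k)_+$ for $0\le k\le l_i-1$; $\alpha_Z$ is the tuple consisting of all $a_{i,k}$ ($1\le i\le r$, $0\le k\le l_i-1$), listed in non-increasing order. For $j=1,\dots,t$ let $l'_j=\max_i m_{ij}$ and $b_{j,k}=\sum_{i=1}^r(m_{ij}-k)_+$ for $0\le k\le l'_j-1$; $\beta_Z$ is the tuple of all $b_{j,k}$ in non-increasing order. $|\alpha_Z|$ denotes the length of the tuple. *)

(* Defs.v *)
From HB Require Import structures.
From mathcomp Require Import all_boot all_order all_algebra.
From mathcomp Require Import mpoly.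
Set Implicit Arguments. Unset Strict Implicit. Unset Printing Implicit Defensive.
Import Order.TTheory GRing.Theory.
Local Open Scope ring_scope.

(* Points of P^1 over k are encoded canonically: Some a = [1:a], None = [0:1].
   A point of P^1 x P^1 is a pair (R, Q).  A fat point scheme is a list of
   (point, multiplicity) pairs.  R = k[x0,x1,y0,y1] = {mpoly k[4]} with
   x0 = 'X_0, x1 = 'X_1, y0 = 'X_2, y1 = 'X_3. *)

Section Defs.
Variable k : closedFieldType.

Definition P1 := option k.
Definition pt := (P1 * P1)%type.
Definition fatscheme := seq (pt * nat).

Definition Rpoly := {mpoly k[4]}.

Definition x0 : Rpoly := 'X_(inord 0).
Definition x1 : Rpoly := 'X_(inord 1).
Definition y0 : Rpoly := 'X_(inord 2).
Definition y1 : Rpoly := 'X_(inord 3).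

(* the linear form a1*x0 - a0*x1 for [a0:a1] *)
Definition lform1 (R : P1) : Rpoly :=
  match R with Some a => a%:MP * x0 - x1 | None => x0 end.
Definition lform2 (Q : P1) : Rpoly :=
  match Q with Some b => b%:MP * y0 - y1 | None => y0 end.

Definition ideal_gen (S : Rpoly -> Prop) (f : Rpoly) : Prop :=
  exists n (g s : 'I_n -> Rpoly), (forall l, S (s l)) /\ f = \sum_l g l * s l.

Definition ideal_pow (I : Rpoly -> Prop) (m : nat) : Rpoly -> Prop :=
  ideal_gen (fun s => exists u : 'I_m -> Rpoly,
                        (forall l, I (u l)) /\ s = \prod_l u l).

Definition pt_ideal (P : pt) : Rpoly -> Prop :=
  ideal_gen (fun s => s = lform1 P.1 \/ s = lform2 P.2).

Definition IZ (Z : fatscheme) (f : Rpoly) : Prop :=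
  forall e, e \in Z -> ideal_pow (pt_ideal e.1) e.2 f.

(* bihomogeneous of bidegree (i,j) (the zero polynomial included) *)
Definition bihom (i j : nat) (p : Rpoly) : Prop :=
  forall m, m \in msupp p ->
    (m (inord 0) + m (inord 1) = i)%N /\ (m (inord 2) + m (inord 3) = j)%N.

(* dim_k (R/I_Z)_(i,j) = n : there is a family of n bihomogeneous polynomials
   of bidegree (i,j) whose classes form a basis of (R/I_Z)_(i,j). *)
Definition hilb_dim (Z : fatscheme) (i j n : nat) : Prop :=
  exists p : 'I_n -> Rpoly,
    [/\ forall l, bihom i j (p l),
        forall c : 'I_n -> k, IZ Z (\sum_l c l *: p l) -> forall l, c l = 0
      & forall q, bihom i j q ->
          exists c : 'I_n -> k, IZ Z (q - \sum_l c l *: p l)].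

(* multiplicity of a point in Z (0 if not in the support) *)
Definition mult (Z : fatscheme) (P : pt) : nat :=
  (\sum_(e <- Z | e.1 == P) e.2)%N.

Definition proj1s (Z : fatscheme) : seq P1 := undup [seq e.1.1 | e <- Z].
Definition proj2s (Z : fatscheme) : seq P1 := undup [seq e.1.2 | e <- Z].

(* l_i and a_{i,k};  nat subtraction is (.)_+ *)
Definition lrow Z (R : P1) : nat := (\max_(Q <- proj2s Z) mult Z (R, Q))%N.
Definition arow Z (R : P1) (kk : nat) : nat :=
  (\sum_(Q <- proj2s Z) (mult Z (R, Q) - kk))%N.
Definition lcol Z (Q : P1) : nat := (\max_(R <- proj1s Z) mult Z (R, Q))%N.
Definition bcol Z (Q : P1) (kk : nat) : nat :=
  (\sum_(R <- proj1s Z) (mult Z (R, Q) - kk))%N.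

Definition alphaZ (Z : fatscheme) : seq nat :=
  sort geq (flatten [seq [seq arow Z R kk | kk <- iota 0 (lrow Z R)]
                    | R <- proj1s Z]).
Definition betaZ (Z : fatscheme) : seq nat :=
  sort geq (flatten [seq [seq bcol Z Q kk | kk <- iota 0 (lcol Z Q)]
                    | Q <- proj2s Z]).

Definition nge (s : seq nat) (kk : nat) : nat := count (fun a => kk <= a)%N s.

End Defs.

(* Main.v *)
(** A form of bidegree (i,j) is a matrix [A] of coefficients, and the linear
    substitution exchanging [x1] (resp. [y1]) with the linear form of a point
    turns membership in the [m]-th power of its ideal into the vanishing of the
    coefficients of order less than [m].  So the form lies in [I_Z] iff the jets
    [F_(R,s)(y)] of order [s] along each line [R] vanish to order [m_RQ - s] at
    every [Q].  Both families of conditions are Hermite interpolation conditions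
    on binary forms, and [N] such conditions on forms of degree [d] have rank
    [min (d+1, N)].  In [x] there are [|alpha_Z| <= i+1] of them, so the jets
    can be prescribed freely; in [y] the jet [F_(R,s)] is subject to [a_(R,s)]
    conditions and contributes [min (j+1, a_(R,s))] to the Hilbert function. *)

Require Import Defs.
From mathcomp Require Import all_boot all_order all_algebra.
From mathcomp Require Import mpoly.
From mathcomp Require Import zify ring.
Set Implicit Arguments. Unset Strict Implicit. Unset Printing Implicit Defensive.
Import GRing.Theory.

(** * Quotient dimensions and linear conditions on the rows of a matrix *)

Section QuotientDimension.
Local Open Scope ring_scope.
Variable k : fieldType.

(** The basis clauses of [hilb_dim] in an arbitrary space; when [W] is a subspace, [n] is the
    dimension of V/W. *)
Definition quotient_dim (V : lmodType k) (W : V -> Prop) (n : nat) : Prop :=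
  exists p : 'I_n -> V,
    (forall c : 'I_n -> k, W (\sum_l c l *: p l) -> forall l, c l = 0) /\
    (forall q, exists c : 'I_n -> k, W (q - \sum_l c l *: p l)).

Lemma quotient_dim_finType (V : lmodType k) (W : V -> Prop) (I : finType)
    (p : I -> V) :
    (forall c : I -> k, W (\sum_l c l *: p l) -> forall l, c l = 0) ->
    (forall q, exists c : I -> k, W (q - \sum_l c l *: p l)) ->
  quotient_dim W #|I|.
Proof.
have reindexE (c : I -> k) :
    \sum_l c l *: p l = \sum_(l < #|I|) c (enum_val l) *: p (enum_val l).
  by rewrite (reindex_omap (@enum_val I predT) (fun x => Some (enum_rank x))) //=
       => [|i _]; [apply: eq_bigl => i; rewrite enum_valK eqxx | rewrite enum_rankK].
move=> free_p span_p; exists (p \o enum_val); split=> [c Wc l | q].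
  rewrite -[l]enum_valK; apply: (free_p (c \o enum_rank)).
  by rewrite reindexE; under eq_bigr do rewrite /= enum_valK.
have [c Wc] := span_p q; exists (c \o enum_val).
by rewrite reindexE in Wc.
Qed.

Lemma quotient_dim_iff (V : lmodType k) (W W' : V -> Prop) n :
  (forall v, W v <-> W' v) -> quotient_dim W n -> quotient_dim W' n.
Proof.
move=> WW' [p [free_p span_p]]; exists p; split=> [c /WW' | q]; first exact: free_p.
by have [c Wc] := span_p q; exists c; apply/WW'.
Qed.

Lemma quotient_dim_tr m q (W : 'M[k]_(m, q) -> Prop) n :
  quotient_dim W n -> quotient_dim (fun A : 'M[k]_(q, m) => W A^T) n.
Proof.
case=> p [free_p span_p]; exists (fun l => (p l)^T).
have trE (c : 'I_n -> k) : (\sum_l c l *: (p l)^T)^T = \sum_l c l *: p l.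
  by rewrite linear_sum; apply: eq_bigr => l _; rewrite linearZ /= trmxK.
split=> [c | A]; first by rewrite trE; apply: free_p.
by have [c Wc] := span_p A^T; exists c; rewrite linearB /= trE.
Qed.

(** The rows of [B] lift a basis of the row space of [M]; the boolean equality lets [xchoose] pick
    such a [B]. *)
Lemma row_base_preimage q r (M : 'M[k]_(q, r)) :
  exists B : 'M[k]_(\rank M, q), B *m M == row_base M.
Proof.
have /submxP [B defB] : (row_base M <= M)%MS by rewrite eq_row_base.
by exists B; rewrite -defB.
Qed.

(* The rows of [E^T *m A] can be prescribed freely, so the conditions imposed
   on distinct rows are independent. *)
Lemma quotient_dim_rowwise m q N (E : 'M[k]_(m, N)) (r : 'I_N -> nat)
    (M : forall n, 'M[k]_(q, r n)) :
  \rank E = N ->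
  quotient_dim (fun A : 'M[k]_(m, q) => forall n, row n (E^T *m A) *m M n = 0)
    (\sum_n \rank (M n))%N.
Proof.
move=> rkE; have freeE : row_free E^T by rewrite /row_free mxrank_tr rkE.
pose B n : 'M[k]_(\rank (M n), q) := xchoose (row_base_preimage (M n)).
have BM n : B n *m M n = row_base (M n).
  exact/eqP/(xchooseP (row_base_preimage (M n))).
(* [D] is a right inverse, so [E^T] sends its n-th column to the n-th unit vector. *)
pose D := pinvmx E^T.
have ED : E^T *m D = 1%:M by rewrite mulmxVp.
pose I := {n : 'I_N & 'I_(\rank (M n))}.
pose tg n (b : 'I_(\rank (M n))) : I := Tagged (fun n => 'I_(\rank (M n))) b.
(* [E^T] sends this matrix to the one whose row [tag l] is a row of [B (tag l)] and whose other rows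
   vanish. *)
pose p (l : I) := col (tag l) D *m row (tagged l) (B (tag l)).
have cardI : #|{: I}| = (\sum_n \rank (M n))%N.
  by rewrite card_tagged sumnE big_map big_enum /=; apply: eq_bigr => n _; rewrite card_ord.
have rowE (c : I -> k) n : row n (E^T *m \sum_l c l *: p l) =
    (\row_b c (tg n b)) *m B n.
  rewrite mulmx_sumr linear_sum /=.
  transitivity (\sum_n0 \sum_b row n (E^T *m (c (tg n0 b) *: p (tg n0 b)))).
    by rewrite (sig_big_dep xpredT (fun _ => xpredT)
      (fun n0 b => row n (E^T *m (c (tg n0 b) *: p (tg n0 b))))) /=;
      apply: eq_bigr => -[].
  have Ep n0 b : row n (E^T *m (c (tg n0 b) *: p (tg n0 b))) =
      (c (tg n0 b) * (n == n0)%:R) *: row b (B n0).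
    rewrite -scalemxAr linearZ /= -scalerA; congr (_ *: _).
    rewrite /p /= mulmxA row_mul.
    rewrite [X in X *m _](_ : _ = (n == n0)%:R%:M) ?mul_scalar_mx //.
    by rewrite colE mulmxA ED mul1mx; apply/rowP=> j; rewrite !mxE !ord1 eqxx andbT.
  rewrite (bigD1 n) //= [X in _ + X]big1 ?addr0 => [|n0 ne_n0]; last first.
    by rewrite big1 // => b _; rewrite Ep eq_sym (negPf ne_n0) mulr0 scale0r.
  rewrite mulmx_sum_row; apply: eq_bigr => b _.
  by rewrite Ep eqxx mulr1 mxE.
rewrite -cardI; apply: (quotient_dim_finType (p := p)) => [c Wc [n b] | A].
  have := Wc n; rewrite rowE -mulmxA BM => /eqP.
  rewrite mulmx_free_eq0 ?row_base_free // => /eqP/rowP/(_ b).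
  by rewrite !mxE.
(* The coordinates of the class of [A] are found row by row, in the basis [row_base (M n)]. *)
have span n : exists u : 'rV[k]_(\rank (M n)), row n (E^T *m A) *m M n == u *m row_base (M n).
  have /submxP [u uE] : (row n (E^T *m A) *m M n <= row_base (M n))%MS.
    by rewrite eq_row_base submxMl.
  by exists u; rewrite uE.
pose u n := xchoose (span n).
exists (fun l => u (tag l) 0 (tagged l)); move=> n.
rewrite mulmxBr linearB /= rowE mulmxBl -mulmxA BM (eqP (xchooseP (span n))).
rewrite [X in _ - X *m _](_ : _ = u n) ?subrr //.
by apply/rowP=> b; rewrite !mxE.
Qed.

End QuotientDimension.

(** * Hermite interpolation for binary forms *)

Section Hermite.
Local Open Scope ring_scope.
Variable k : fieldType.
Local Notation P1 := (option k).

(* Coefficient of [x0^(d-s) x1^s] in the image of [x0^(d-n) x1^n] under the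
   substitution exchanging [x1] with the linear form of the point [R]:
   [x1 |-> a x0 - x1] at [1:a], and [x0 <-> x1] at [0:1]. *)
Definition jet_coef (d : nat) (R : P1) (n s : nat) : k :=
  match R with
  | Some a => ((-1) ^+ s * a ^+ (n - s)) *+ 'C(n, s)
  | None => (n + s == d)%N%:R
  end.

Definition jet (d : nat) (R : P1) (s : nat) : 'cV[k]_d.+1 :=
  \col_n jet_coef d R n s.

Definition jets (d : nat) (T : seq (P1 * nat)) : 'M[k]_(d.+1, size T) :=
  \matrix_(n, l) jet_coef d (tnth (in_tuple T) l).1 n (tnth (in_tuple T) l).2.

Definition conditions (Rs : seq P1) (mu : P1 -> nat) : seq (P1 * nat) :=
  [seq (R, s) | R <- Rs, s <- iota 0 (mu R)].

Lemma mem_conditions Rs mu R s :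
  ((R, s) \in conditions Rs mu) = (R \in Rs) && (s < mu R)%N.
Proof.
apply/allpairsPdep/andP => [[R' [s' [RsR' + [-> ->]]]] | [RsR lt_s]].
  by rewrite mem_iota.
by exists R, s; rewrite mem_iota.
Qed.

Lemma size_conditions Rs mu :
  size (conditions Rs mu) = (\sum_(R <- Rs) mu R)%N.
Proof.
rewrite size_allpairs_dep sumnE big_map; apply: eq_bigr => R _.
by rewrite size_iota.
Qed.

Lemma col_jets d T l :
  col l (jets d T) = jet d (tnth (in_tuple T) l).1 (tnth (in_tuple T) l).2.
Proof. by apply/colP=> n; rewrite !mxE. Qed.

Lemma mul_jets_eq0 d T m (v : 'M[k]_(m, d.+1)) :
  v *m jets d T = 0 <-> forall e, e \in T -> v *m jet d e.1 e.2 = 0.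
Proof.
split=> [vT e /seq_tnthP [l ->] | vT].
  by rewrite -col_jets colE mulmxA vT mul0mx.
apply/matrixP=> a l; have := vT _ (mem_tnth l (in_tuple T)).
by rewrite -col_jets colE mulmxA -colE => /colP/(_ a); rewrite !mxE.
Qed.

Lemma coef_exprBX (a : k) n s :
  ((a%:P - 'X) ^+ n)`_s = jet_coef 0 (Some a) n s.
Proof.
rewrite exprBn coef_sum /=.
have coefE j : ((-1) ^+ j * a%:P ^+ (n - j) * 'X^j *+ 'C(n, j) : {poly k})`_s =
    ((-1) ^+ j * a ^+ (n - j) * (s == j)%:R) *+ 'C(n, j).
  by rewrite coefMn -polyC1 -polyCN -!polyC_exp -polyCM coefCM coefXn.
under eq_bigr do rewrite coefE.
have [lt_ns | le_sn] := ltnP n s.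
  rewrite bin_small // mulr0n big1 // => j _.
  by rewrite gtn_eqF ?mulr0 ?mul0rn // (leq_trans _ lt_ns).
rewrite -ltnS in le_sn; rewrite (bigD1 (Ordinal le_sn)) //= eqxx mulr1.
rewrite big1 ?addr0 // => j ne_j; rewrite eq_sym.
by move: ne_j; rewrite -(inj_eq val_inj) /= => /negPf->; rewrite mulr0 mul0rn.
Qed.

(** Setting x0 = 1 turns the form [v] into a polynomial, whose Taylor coefficients at [a] are, up to
    sign, the jets at [1:a]. *)
Lemma mul_jet_Some d (v : 'rV[k]_d.+1) a s :
  (v *m jet d (Some a) s) 0 0 = ((\sum_n v 0 n *: 'X^n) \Po (a%:P - 'X))`_s.
Proof.
rewrite mxE linear_sum coef_sum; apply: eq_bigr => n _.
by rewrite linearZ /= comp_Xn_poly coefZ coef_exprBX mxE.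
Qed.

Lemma coef_sum_row d (v : 'rV[k]_d.+1) (n : 'I_d.+1) :
  (\sum_n v 0 n *: 'X^n)`_n = v 0 n.
Proof.
rewrite coef_sum (bigD1 n) //= big1 ?addr0 => [|j ne_jn].
  by rewrite coefZ coefXn eqxx mulr1.
by rewrite coefZ coefXn eq_sym (inj_eq val_inj) (negPf ne_jn) mulr0.
Qed.

Lemma size_sum_row d (v : 'rV[k]_d.+1) : (size (\sum_n v 0%R n *: 'X^n)%R <= d.+1)%N.
Proof.
apply: (leq_trans (size_sum _ _ _)); apply/bigmax_leqP => n _.
by apply: (leq_trans (size_scale_leq _ _)); rewrite size_polyXn.
Qed.

(** The jets at infinity are the coefficients read from the top, so their vanishing lowers the
    degree. The bound on [s] keeps [d - s] from being truncated. *)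
Lemma mul_jet_None d (v : 'rV[k]_d.+1) s : (s <= d)%N ->
  (v *m jet d None s) 0 0 = (\sum_n v 0 n *: 'X^n)`_(d - s).
Proof.
move=> le_sd; have lt_ds : (d - s < d.+1)%N by rewrite ltnS leq_subr.
rewrite -[(d - s)%N]/(val (Ordinal lt_ds)) coef_sum_row mxE.
rewrite (bigD1 (Ordinal lt_ds)) //= big1 ?addr0 => [|j ne_j].
  by rewrite mxE /= subnK // eqxx mulr1.
rewrite mxE /=; case: eqP => [sum_d|]; last by rewrite mulr0.
by case/eqP: ne_j; apply: val_inj => /=; lia.
Qed.

(** Substituting [a - X] for [X] is an involution that exchanges [X] and [X - a] up to sign, so
    divisibility of [q] by a power of [X] transfers to [p]. *)
Lemma dvdp_exp_coef (p : {poly k}) a m :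
  (forall s, (s < m)%N -> (p \Po (a%:P - 'X))`_s = 0) -> ('X - a%:P) ^+ m %| p.
Proof.
set q := p \Po _ => q0.
have pq : p = q \Po (a%:P - 'X).
  rewrite /q -comp_polyA !linearB /= comp_polyC comp_polyX opprB addrC subrK.
  by rewrite comp_polyXr.
have take0 : take_poly m q = 0.
  apply/polyP=> s; rewrite coef_take_poly coef0; case: ifP => // lt_s.
  exact: q0.
rewrite pq -(poly_take_drop m q) take0 add0r comp_polyM comp_Xn_poly dvdp_mull //.
by rewrite -[a%:P - 'X]opprB exprNn dvdp_mull.
Qed.

Lemma dvdp_prod_exp (p : {poly k}) (As : seq k) (mu : k -> nat) : uniq As ->
    (forall a, a \in As -> ('X - a%:P) ^+ mu a %| p) ->
  \prod_(a <- As) ('X - a%:P) ^+ mu a %| p.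
Proof.
elim: As => [|a As IH] /=; first by rewrite big_nil dvd1p.
case/andP=> nAa uAs dvd_p; rewrite big_cons Gauss_dvdp; last first.
  rewrite coprimep_sym; apply/coprimep_expr; rewrite big_seq.
  elim/big_ind: _ => [|q1 q2|b Asb].
  - by rewrite coprime1p.
  - by rewrite coprimepMl => -> ->.
  - rewrite coprimep_expl // coprimep_XsubC root_XsubC eq_sym.
    by apply: contraNneq nAa => <-.
rewrite dvd_p ?mem_head // IH // => b Asb.
by rewrite dvd_p // inE Asb orbT.
Qed.

(* A nonzero binary form of degree [d] has at most [d] zeros on P^1, counted
   with multiplicity; the zero at infinity is the drop of the degree. *)
Lemma jets_inj d (Rs : seq P1) (mu : P1 -> nat) (v : 'rV[k]_d.+1) : uniq Rs ->
  (d < \sum_(R <- Rs) mu R)%N -> v *m jets d (conditions Rs mu) = 0 -> v = 0.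
Proof.
move=> uRs lt_d /mul_jets_eq0 vT.
have {vT} v0 R s : R \in Rs -> (s < mu R)%N -> v *m jet d R s = 0.
  by move=> RsR lt_s; apply: (vT (R, s)); rewrite mem_conditions RsR.
set p : {poly k} := \sum_n v 0 n *: 'X^n.
suff p0 : p = 0 by apply/rowP=> n; rewrite -coef_sum_row -/p p0 coef0 mxE.
(* The finite points give linear factors of [p]; the point [0:1] is treated through the degree. *)
pose As := pmap id Rs.
have AsE a : (a \in As) = (Some a \in Rs).
  by rewrite mem_pmap; apply/mapP/idP => [[[b|] Rb // [->]] | Ra] //; exists (Some a).
have uAs : uniq As by apply: (pmap_uniq (g := some)) => // -[].
have dvd_p : \prod_(a <- As) ('X - a%:P) ^+ mu (Some a) %| p.
  apply: (dvdp_prod_exp (mu := mu \o some)) => // a; rewrite AsE => Ra.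
  by apply: dvdp_exp_coef => s lt_s; rewrite -mul_jet_Some v0 // mxE.
apply/eqP; apply: contraTT lt_d => nz_p; have := dvdp_leq nz_p dvd_p; rewrite -leqNgt.
have -> : size (\prod_(a <- As) ('X - a%:P) ^+ mu (Some a)) =
    (\sum_(a <- As) mu (Some a)).+1.
  rewrite size_prod_seq => [|a _]; last by rewrite expf_neq0 ?polyXsubC_eq0.
  under eq_bigr do rewrite size_exp_XsubC -addn1.
  rewrite big_split /= sum1_size -addn1. lia.
have sumE Ss : uniq Ss -> (\sum_(R <- Ss) mu R =
    \sum_(a <- pmap id Ss) mu (Some a) + (None \in Ss) * mu None)%N.
  elim: Ss => [|[a|] Ss IH] /=; rewrite ?big_nil ?big_cons //.
    by case/andP=> _ /IH ->; rewrite addnA inE.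
  by case/andP=> nSs /IH ->; rewrite (negPf nSs) mul0n addn0 mul1n addnC.
rewrite (sumE _ uRs) -/As.
(* The zero at infinity removes the top [mu None] coefficients. Comparing with the degree of the
   divisor bounds the total multiplicity by [d]. *)
suff : (size p <= d.+1 - (None \in Rs) * mu None)%N.
  by move: (size p) (\sum_(a <- As) _)%N (_ * _)%N => n S c; lia.
have [RN | _] := boolP (None \in Rs); last by rewrite mul0n subn0 size_sum_row.
rewrite mul1n; apply/leq_sizeP => n le_n.
have [le_nd | lt_dn] := leqP n d; last first.
  by rewrite nth_default // (leq_trans (size_sum_row v)).
by rewrite -(subKn le_nd) -mul_jet_None ?leq_subr // v0 ?mxE //; lia.
Qed.

Lemma mxrank_inj m n (A : 'M[k]_(m, n)) :
  (forall v : 'rV_m, v *m A = 0 -> v = 0) -> \rank A = m.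
Proof.
move=> injA; apply/eqP; rewrite -[_ == _]/(row_free A) -kermx_eq0.
apply/eqP/row_matrixP => a; rewrite row0; apply: injA.
by rewrite -row_mul mulmx_ker row0.
Qed.

(** With at least [d.+1] conditions, [jets_inj] gives rank [d.+1]. Fewer conditions extend to a
    system of exactly [d.+1] of full rank, hence are independent. *)
Lemma rank_jets d (Rs : seq P1) (mu : P1 -> nat) : uniq Rs ->
  \rank (jets d (conditions Rs mu)) = minn d.+1 (\sum_(R <- Rs) mu R).
Proof.
move=> uRs; have [lt_d | le_d] := leqP d.+1 (\sum_(R <- Rs) mu R).
  by apply: mxrank_inj => v; apply: jets_inj.
apply/eqP; rewrite eqn_leq -{1}size_conditions rank_leq_col /=.
(* Without any point there is no multiplicity to raise, but the bound to prove is then 0. *)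
case: Rs uRs le_d => [|R0 Rs] uRs le_d; first by rewrite big_nil.
(* Raise the multiplicity of one point until the conditions determine the form. *)
pose e := (d.+1 - \sum_(R <- R0 :: Rs) mu R)%N.
pose mu' R := (mu R + (R == R0) * e)%N.
have rk' : \rank (jets d (conditions (R0 :: Rs) mu')) = d.+1.
  apply: mxrank_inj => v; apply: jets_inj => //.
  rewrite big_split /= [X in (_ + X)%N]big_cons eqxx mul1n /e. lia.
pose T2 := [seq (R0, mu R0 + q)%N | q <- iota 0 e].
have sub : ((jets d (conditions (R0 :: Rs) mu'))^T <=
    (jets d (conditions (R0 :: Rs) mu))^T + (jets d T2)^T)%MS.
  apply/row_subP => l; rewrite -tr_col col_jets.
  case: (tnth _ l) (mem_tnth l (in_tuple (conditions (R0 :: Rs) mu'))) => R s.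
  rewrite mem_conditions /= => /andP [RsR]; rewrite /mu' => lt_s.
  have subT T : (R, s) \in T -> ((jet d R s)^T <= (jets d T)^T)%MS.
    case/seq_tnthP=> l'; rewrite /tnth /= => E.
    have -> : jet d R s = col l' (jets d T).
      by rewrite col_jets [tnth _ _](_ : _ = (R, s)) // E.
    by rewrite tr_col row_sub.
  have [lt_s' | le_s] := ltnP s (mu R).
    by apply: (submx_trans (subT _ _) (addsmxSl _ _)); rewrite mem_conditions RsR.
  have R0E : R = R0 by apply/eqP; apply: contraTT lt_s => /negPf->; lia.
  apply: (submx_trans (subT _ _) (addsmxSr _ _)); apply/mapP.
  exists (s - mu R)%N; last by rewrite -R0E subnKC.
  by rewrite mem_iota; move: lt_s; rewrite R0E eqxx; lia.
(* The added conditions [T2] have rank at most [e], so the original ones account for the rest of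
   [d.+1]. *)
have := leq_trans (mxrankS sub) (mxrank_adds_leqif _ _).
rewrite !mxrank_tr rk'.
have := rank_leq_col (jets d T2).
have : size T2 = (d.+1 - \sum_(R <- R0 :: Rs) mu R)%N by rewrite size_map size_iota.
set r := \rank (jets d T2); set r' := \rank (jets d (conditions _ mu)).
by move: r r' (size T2) (\sum_(R <- _) _)%N le_d => a b c S; lia.
Qed.

End Hermite.

(** * Vanishing conditions on a coefficient matrix *)

Section Vanishing.
Local Open Scope ring_scope.
Variable k : fieldType.
Local Notation P1 := (option k).

(** By [swap_form], the product is the coefficient of order [s] in x1 and [t] in y1 after the
    substitution at the point (R,Q). *)
Definition vanishing i j (Rs Qs : seq P1) (mu : P1 -> P1 -> nat)
    (A : 'M[k]_(i.+1, j.+1)) : Prop :=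
  forall R Q s t, R \in Rs -> Q \in Qs -> (s + t < mu R Q)%N ->
    (jet i R s)^T *m A *m jet j Q t = 0.

(** As [l R] bounds the multiplicities on the line [R], the pairs (R,s) with [s < l R] cover all
    conditions. There are at most [i.+1] of them, so their jets are independent and
    [quotient_dim_rowwise] applies. *)
Lemma quotient_dim_vanishing i j (Rs Qs : seq P1) (mu : P1 -> P1 -> nat)
    (l : P1 -> nat) : uniq Rs -> uniq Qs ->
    (forall R Q, R \in Rs -> Q \in Qs -> mu R Q <= l R)%N ->
    (\sum_(R <- Rs) l R <= i.+1)%N ->
  quotient_dim (@vanishing i j Rs Qs mu)
    (\sum_(R <- Rs) \sum_(s <- iota 0 (l R))
        minn j.+1 (\sum_(Q <- Qs) (mu R Q - s)))%N.
Proof.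
move=> uRs uQs le_mu le_l.
pose T := conditions Rs l; pose e n := tnth (in_tuple T) n.
(* The conditions in y left on the jet of order [e.2] along the line [e.1]. *)
pose T2 (e : P1 * nat) := conditions Qs (fun Q => mu e.1 Q - e.2)%N.
have rkE : \rank (jets i T) = size T.
  by rewrite rank_jets // size_conditions; apply/minn_idPr.
have := quotient_dim_rowwise (fun n => jets j (T2 (e n))) rkE.
have -> : (\sum_n \rank (jets j (T2 (e n))))%N = (\sum_(R <- Rs)
    \sum_(s <- iota 0 (l R)) minn j.+1 (\sum_(Q <- Qs) (mu R Q - s)))%N.
  under eq_bigr do rewrite rank_jets //.
  rewrite -(big_tnth _ _ (in_tuple T) xpredT
    (fun e => minn j.+1 (\sum_(Q <- Qs) (mu e.1 Q - e.2))))%N /=.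
  by rewrite /T /conditions big_allpairs_dep.
apply: quotient_dim_iff => A.
have rowT n : row n ((jets i T)^T *m A) = (jet i (e n).1 (e n).2)^T *m A.
  by rewrite row_mul -tr_col col_jets.
split=> [WA R Q s t RsR QsQ lt_st | vA n].
  have /seq_tnthP [n en] : (R, s) \in T.
    by rewrite mem_conditions RsR (leq_trans _ (le_mu _ _ RsR QsQ)) //; lia.
  have := WA n; rewrite rowT -[e n]en /= => /mul_jets_eq0/(_ (Q, t)); apply.
  by rewrite mem_conditions QsQ /=; lia.
rewrite rowT; apply/mul_jets_eq0 => -[Q t]; rewrite mem_conditions => /andP[QsQ lt_t].
have : e n \in T := mem_tnth n (in_tuple T).
case: (e n) lt_t => R s /= lt_t; rewrite mem_conditions => /andP[RsR _].
by apply: vA => //; lia.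
Qed.

(** Exchanging the two factors of the product transposes the matrix; this reduces the statement on
    [betaZ] to the case of rows. *)
Lemma vanishing_tr i j (Rs Qs : seq P1) (mu : P1 -> P1 -> nat)
    (A : 'M[k]_(i.+1, j.+1)) :
  vanishing Qs Rs (fun Q R => mu R Q) A^T <-> vanishing Rs Qs mu A.
Proof.
split=> vA R Q s t RsR QsQ lt_st; apply: trmx_inj.
  by rewrite trmx0 !trmx_mul trmxK mulmxA; apply: vA => //; rewrite addnC.
by rewrite trmx0 !trmx_mul !trmxK mulmxA; apply: vA => //; rewrite addnC.
Qed.

End Vanishing.

(** * The linear substitution attached to a point *)

Section FatPoints.
Local Open Scope ring_scope.
Variable k : closedFieldType.
Local Notation Rpoly := (Rpoly k).
Local Notation x0 := (x0 k). Local Notation x1 := (x1 k).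
Local Notation y0 := (y0 k). Local Notation y1 := (y1 k).

Lemma ord4_ind (F : 'I_4 -> Prop) :
  F (inord 0) -> F (inord 1) -> F (inord 2) -> F (inord 3) -> forall i, F i.
Proof.
move=> F0 F1 F2 F3 i; rewrite -[i]inord_val.
by case: i => -[|[|[|[|i]]]].
Qed.

(** Completes [point_form R u v] to a basis of the span of [u] and [v]. *)
Definition compl_form (R : P1 k) (u v : Rpoly) : Rpoly := if R is Some _ then u else v.
Definition point_form (R : P1 k) (u v : Rpoly) : Rpoly :=
  if R is Some a then a%:MP * u - v else u.

Lemma lform1E R : lform1 R = point_form R x0 x1. Proof. by case: R. Qed.
Lemma lform2E R : lform2 R = point_form R y0 y1. Proof. by case: R. Qed.

(** This binomial expansion is the source of the formula for [jet_coef]. *)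
Lemma form_expansion d R (u v : Rpoly) n : (n <= d)%N ->
  compl_form R u v ^+ (d - n) * point_form R u v ^+ n =
  \sum_(s < d.+1) jet_coef d R n s *: (u ^+ (d - s) * v ^+ s).
Proof.
move=> le_nd; case: R => [a|] /=; last first.
  have lt_dn : (d - n < d.+1)%N by rewrite ltnS leq_subr.
  rewrite (bigD1 (Ordinal lt_dn)) //= subnKC // eqxx scale1r subKn // mulrC.
  rewrite big1 ?addr0 // => s ne_s; case: eqP => [sum_d|]; last by rewrite scale0r.
  by case/eqP: ne_s; apply: val_inj => /=; lia.
(* The sum up to [n] is extended to [d]; the new binomial coefficients are zero. *)
rewrite exprBn mulr_sumr (big_ord_widen_cond d.+1 xpredT
  (fun s => u ^+ (d - n) * ((-1) ^+ s * (a%:MP * u) ^+ (n - s) * v ^+ s *+ 'C(n, s)))) //.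
rewrite big_mkcond; apply: eq_bigr => s _ /=; rewrite ltnS.
case: leqP => [le_sn | lt_ns]; last by rewrite bin_small // mulr0n scale0r.
rewrite -mul_mpolyC mpolyCMn mpolyCM !rmorphXn /= mpolyCN mpolyC1 exprMn.
have -> : (d - s = (d - n) + (n - s))%N by lia.
by rewrite exprD; ring.
Qed.

(* The involution exchanging [x1] and [y1] with the two linear forms of [P]. *)
Definition swap (P : pt k) : 4.-tuple Rpoly :=
  [tuple compl_form P.1 x0 x1; point_form P.1 x0 x1;
         compl_form P.2 y0 y1; point_form P.2 y0 y1].

Lemma swap_x0 P : x0 \mPo swap P = compl_form P.1 x0 x1.
Proof. by rewrite comp_mpolyXU inordK. Qed.
Lemma swap_x1 P : x1 \mPo swap P = point_form P.1 x0 x1.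
Proof. by rewrite comp_mpolyXU inordK. Qed.
Lemma swap_y0 P : y0 \mPo swap P = compl_form P.2 y0 y1.
Proof. by rewrite comp_mpolyXU inordK. Qed.
Lemma swap_y1 P : y1 \mPo swap P = point_form P.2 y0 y1.
Proof. by rewrite comp_mpolyXU inordK. Qed.

Definition swapE := (swap_x0, swap_x1, swap_y0, swap_y1).

Lemma swap_lform1 P : lform1 P.1 \mPo swap P = x1.
Proof.
rewrite lform1E; case: P => -[a|] Q; rewrite /= ?rmorphB ?rmorphM /= ?comp_mpolyC !swapE //=.
by rewrite opprB addrC subrK.
Qed.

Lemma swap_lform2 P : lform2 P.2 \mPo swap P = y1.
Proof.
rewrite lform2E; case: P => R [a|]; rewrite /= ?rmorphB ?rmorphM /= ?comp_mpolyC !swapE //=.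
by rewrite opprB addrC subrK.
Qed.

(** Substitution is an algebra morphism, so it suffices to check the four variables. *)
Lemma swapK P f : (f \mPo swap P) \mPo swap P = f.
Proof.
rewrite (comp_mpolyEX f) [RHS](mpolyE f) raddf_sum; apply: eq_bigr => m _.
rewrite /= comp_mpolyZ; congr (_ *: _); rewrite mpolyXE_id !rmorph_prod.
apply: eq_bigr => i _; rewrite !rmorphXn /=; congr (_ ^+ _).
elim/ord4_ind: i; rewrite -/x0 -/x1 -/y0 -/y1.
- by rewrite swapE; case: P => -[a|] Q; rewrite /= swapE.
- by rewrite swap_x1 -lform1E swap_lform1.
- by rewrite swapE; case: P => R [a|]; rewrite /= swapE.
- by rewrite swap_y1 -lform2E swap_lform2.
Qed.

(** * Powers of a point ideal and order of vanishing *)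

Definition order_ge (m : nat) (f : Rpoly) : Prop :=
  forall u, u \in msupp f -> (m <= u (inord 1) + u (inord 3))%N.

Lemma order_ge_sum m (I : Type) (r : seq I) (F : I -> Rpoly) :
  (forall i, order_ge m (F i)) -> order_ge m (\sum_(i <- r) F i).
Proof.
move=> geF; elim/big_ind: _ => [u|f g gef geg u /msuppD_le|//].
  by rewrite msupp0.
by rewrite mem_cat => /orP[/gef|/geg].
Qed.

Lemma order_geM m n f g :
  order_ge m f -> order_ge n g -> order_ge (m + n) (f * g).
Proof.
move=> gef geg u /msuppM_le /allpairsP [[v w] [/gef gev /geg gew ->]] /=.
by rewrite !mnmDE addnACA leq_add.
Qed.

Lemma order_ge_prod m (F : 'I_m -> Rpoly) :
  (forall l, order_ge 1 (F l)) -> order_ge m (\prod_l F l).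
Proof.
elim: m F => [|m IH] F geF; first by [].
by rewrite big_ord_recl; apply: (@order_geM 1 m) => //; apply: IH.
Qed.

(** Used to select exactly [m] linear factors, [p] of the first kind if possible and the others of
    the second. *)
Lemma prod_if (a b : Rpoly) m p :
  \prod_(q < m) (if (q < p)%N then a else b) = a ^+ minn m p * b ^+ (m - p).
Proof.
elim: m => [|m IH]; first by rewrite big_ord0 min0n sub0n mulr1.
rewrite big_ord_recr IH /=; case: ifP => lt_mp.
  have [-> -> -> ->] : [/\ minn m p = m, minn m.+1 p = m.+1, m - p = 0 & m.+1 - p = 0]%N.
    by split; lia.
  by rewrite !mulr1 exprSr.
have [-> -> ->] : [/\ minn m p = p, minn m.+1 p = p & m.+1 - p = (m - p).+1]%N.
  by split; lia.
by rewrite exprSr mulrA.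
Qed.

Lemma pt_ideal_lform1 (P : pt k) : pt_ideal P (lform1 P.1).
Proof.
exists 1%N, (fun=> 1), (fun=> lform1 P.1); split; first by left.
by rewrite big_ord1 mul1r.
Qed.

Lemma pt_ideal_lform2 (P : pt k) : pt_ideal P (lform2 P.2).
Proof.
exists 1%N, (fun=> 1), (fun=> lform2 P.2); split; first by right.
by rewrite big_ord1 mul1r.
Qed.

(** The substitution carries the ideal of [P] to (x1,y1), whose powers are monomial ideals described
    by [order_ge]. *)
Lemma ideal_pow_order P m f :
  ideal_pow (pt_ideal P) m f <-> order_ge m (f \mPo swap P).
Proof.
split=> [[n [g [s [Is ->]]]] | gef].
  rewrite (raddf_sum (comp_mpoly (swap P))); apply: order_ge_sum => l; rewrite /= rmorphM.
  apply: (@order_geM 0 m) => //; have [u [Iu ->]] := Is l.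
  rewrite rmorph_prod; apply: order_ge_prod => q.
  have [n' [g' [s' [Is' ->]]]] := Iu q.
  rewrite (raddf_sum (comp_mpoly (swap P))); apply: order_ge_sum => l'; rewrite /= rmorphM.
  apply: (@order_geM 0 1) => // v; have [->|->] := Is' l'.
    by rewrite /= swap_lform1 => /mem_msuppXP <-; rewrite !mnm1E eqxx.
  by rewrite /= swap_lform2 => /mem_msuppXP <-; rewrite !mnm1E eqxx addn1.
set h := f \mPo swap P in gef.
pose mon l := tnth (in_tuple (msupp h)) l.
pose L1 := lform1 P.1; pose L2 := lform2 P.2.
(* One term per monomial of [h]: [m] of its factors x1 and y1, x1 first, form the generator, and
   what is left goes into the coefficient. *)
exists (size (msupp h)),
  (fun l => h@_(mon l) *: (compl_form P.1 x0 x1 ^+ mon l (inord 0)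
      * compl_form P.2 y0 y1 ^+ mon l (inord 2)
      * L1 ^+ (mon l (inord 1) - m) * L2 ^+ (mon l (inord 3) - (m - mon l (inord 1))))),
  (fun l => \prod_(q < m) (if (q < mon l (inord 1))%N then L1 else L2)).
split=> [l|].
  exists (fun q : 'I_m => if (q < mon l (inord 1))%N then L1 else L2); split=> // q.
  by case: ifP => _; [apply: pt_ideal_lform1 | apply: pt_ideal_lform2].
rewrite -[LHS](swapK P) -/h [in LHS](mpolyE h) (raddf_sum (comp_mpoly (swap P))) (big_tnth _ _ (msupp h)) /=.
apply: eq_bigr => l _; rewrite -/(mon l) linearZ /= -scalerAl; congr (_ *: _).
have gel := gef _ (mem_tnth l (in_tuple (msupp h))); rewrite -/(mon l) in gel.
move: (mon l) gel => u gel.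
have -> : 'X_[u] = x0 ^+ u (inord 0) * x1 ^+ u (inord 1) * y0 ^+ u (inord 2) * y1 ^+ u (inord 3).
  rewrite mpolyXE_id !big_ord_recl big_ord0 mulr1 !mulrA.
  by do !congr (_ * _); congr ('X_ _ ^+ u _); apply: val_inj; rewrite /= inordK.
rewrite !rmorphM !rmorphXn /= !swapE -lform1E -lform2E -/L1 -/L2 prod_if.
have e1 : u (inord 1) = ((u (inord 1) - m) + minn m (u (inord 1)))%N by lia.
(* The order bound [gel] ensures that y1 occurs often enough to complete the [m] factors. *)
have e3 : u (inord 3) = ((u (inord 3) - (m - u (inord 1))) + (m - u (inord 1)))%N by lia.
by rewrite [in LHS]e1 [in LHS]e3 !exprD; ring.
Qed.

(** * Bihomogeneous forms as coefficient matrices *)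

Definition bimon (i j s t : nat) : 'X_{1..4} :=
  (U_(inord 0) *+ (i - s) + U_(inord 1) *+ s
   + U_(inord 2) *+ (j - t) + U_(inord 3) *+ t)%MM.

Lemma bimonE i j s t :
  [/\ bimon i j s t (inord 0) = (i - s)%N, bimon i j s t (inord 1) = s,
      bimon i j s t (inord 2) = (j - t)%N & bimon i j s t (inord 3) = t].
Proof.
by split; rewrite /bimon !mnmDE !mulmnE !mnm1E -!(inj_eq val_inj) /= !inordK //=; lia.
Qed.

Lemma bimon_X i j s t :
  'X_[bimon i j s t] = (x0 ^+ (i - s) * x1 ^+ s) * (y0 ^+ (j - t) * y1 ^+ t).
Proof. by rewrite /bimon !mpolyXD -!mpolyXn !mulrA. Qed.

Lemma bihom_bimon i j (u : 'X_{1..4}) :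
  (u (inord 0) + u (inord 1) = i)%N -> (u (inord 2) + u (inord 3) = j)%N ->
  u = bimon i j (u (inord 1)) (u (inord 3)).
Proof.
move=> ui uj; have [e0 e1 e2 e3] := bimonE i j (u (inord 1)) (u (inord 3)).
by apply/mnmP; elim/ord4_ind; rewrite ?e0 ?e1 ?e2 ?e3 //; lia.
Qed.

Definition form_of_mx i j (A : 'M[k]_(i.+1, j.+1)) : Rpoly :=
  \sum_s \sum_t A s t *: 'X_[bimon i j s t].

Lemma mcoeff_form i j (A : 'M[k]_(i.+1, j.+1)) (s : 'I_i.+1) (t : 'I_j.+1) :
  (form_of_mx A)@_(bimon i j s t) = A s t.
Proof.
have inj (s' : 'I_i.+1) (t' : 'I_j.+1) :
    (bimon i j s' t' == bimon i j s t) = (s' == s) && (t' == t).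
  apply/eqP/andP => [E | [/eqP-> /eqP->] //].
  have [_ e1 _ e3] := bimonE i j s t; have [_ e1' _ e3'] := bimonE i j s' t'.
  by rewrite E e1 in e1'; rewrite E e3 in e3'; split; apply/eqP/val_inj.
rewrite /form_of_mx raddf_sum (bigD1 s) //= [X in _ + X]big1 ?addr0 => [|s' ne_s].
  rewrite raddf_sum (bigD1 t) //= [X in _ + X]big1 ?addr0 => [|t' ne_t].
    by rewrite mcoeffZ mcoeffX eqxx mulr1.
  by rewrite mcoeffZ mcoeffX inj (negPf ne_t) andbF mulr0.
by rewrite raddf_sum big1 // => t' _; rewrite /= mcoeffZ mcoeffX inj (negPf ne_s) mulr0.
Qed.

Lemma msupp_form i j (A : 'M[k]_(i.+1, j.+1)) u : u \in msupp (form_of_mx A) ->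
  exists (s : 'I_i.+1) (t : 'I_j.+1), u = bimon i j s t.
Proof.
move=> Au; suff /existsP [s /existsP [t /eqP ->]] :
  [exists s : 'I_i.+1, exists t : 'I_j.+1, u == bimon i j s t] by exists s, t.
apply: contraLR Au => no_bimon; rewrite -mcoeff_eq0; apply/eqP.
rewrite /form_of_mx raddf_sum big1 // => s _ /=; rewrite raddf_sum big1 // => t _ /=.
rewrite mcoeffZ mcoeffX; case: eqP => [E|]; last by rewrite mulr0.
by case/existsP: no_bimon; exists s; apply/existsP; exists t; rewrite E.
Qed.

Lemma bihom_form i j (A : 'M[k]_(i.+1, j.+1)) : bihom i j (form_of_mx A).
Proof.
move=> u /msupp_form [s [t ->]]; have [-> -> -> ->] := bimonE i j s t.
by have := ltn_ord s; have := ltn_ord t; lia.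
Qed.

Lemma form_of_mxK i j (q : Rpoly) : bihom i j q ->
  q = form_of_mx (\matrix_(s < i.+1, t < j.+1) q@_(bimon i j s t)).
Proof.
move=> hq; apply/mpolyP => u.
have [/andP [/eqP ui /eqP uj] | nu] := boolP ((u (inord 0) + u (inord 1) == i)
    && (u (inord 2) + u (inord 3) == j))%N; last first.
  rewrite !memN_msupp_eq0 //; apply: contra nu.
    by case/bihom_form => -> ->; rewrite !eqxx.
  by case/hq => -> ->; rewrite !eqxx.
have lt1 : (u (inord 1) < i.+1)%N by lia.
have lt3 : (u (inord 3) < j.+1)%N by lia.
rewrite (bihom_bimon ui uj) -[u (inord 1)]/(val (Ordinal lt1)).
by rewrite -[u (inord 3)]/(val (Ordinal lt3)) mcoeff_form mxE.
Qed.

Lemma form_of_mx_sum i j n (c : 'I_n -> k) (p : 'I_n -> 'M[k]_(i.+1, j.+1)) :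
  form_of_mx (\sum_l c l *: p l) = \sum_l c l *: form_of_mx (p l).
Proof.
under [RHS]eq_bigr do rewrite /form_of_mx scaler_sumr.
rewrite [RHS]exchange_big; apply: eq_bigr => s _ /=.
under [RHS]eq_bigr do rewrite scaler_sumr.
rewrite [RHS]exchange_big; apply: eq_bigr => t _ /=.
rewrite summxE scaler_suml; apply: eq_bigr => l _.
by rewrite mxE scalerA.
Qed.

Lemma form_of_mxB i j (A B : 'M[k]_(i.+1, j.+1)) :
  form_of_mx (A - B) = form_of_mx A - form_of_mx B.
Proof.
rewrite /form_of_mx -sumrB; apply: eq_bigr => s _; rewrite -sumrB.
by apply: eq_bigr => t _; rewrite !mxE scalerBl.
Qed.

(** The substitution acts separately on the x and y parts of each monomial, hence multiplies the
    coefficient matrix by jets on both sides. *)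
Lemma swap_form i j (P : pt k) (A : 'M[k]_(i.+1, j.+1)) :
  form_of_mx A \mPo swap P = form_of_mx
    (\matrix_(s < i.+1, t < j.+1) ((jet i P.1 s)^T *m A *m jet j P.2 t) 0 0).
Proof.
transitivity (\sum_(a < i.+1) \sum_(b < j.+1) \sum_(s < i.+1) \sum_(t < j.+1)
    (jet_coef i P.1 a s * A a b * jet_coef j P.2 b t) *: 'X_[k, bimon i j s t]).
  rewrite /form_of_mx raddf_sum; apply: eq_bigr => a _ /=.
  rewrite raddf_sum; apply: eq_bigr => b _ /=.
  rewrite comp_mpolyZ bimon_X !rmorphM !rmorphXn /= !swapE.
  rewrite !form_expansion -1?ltnS // mulr_suml scaler_sumr; apply: eq_bigr => s _.
  rewrite mulr_sumr scaler_sumr; apply: eq_bigr => t _.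
  by rewrite bimon_X -scalerAl -scalerAr !scalerA; congr (_ *: _); ring.
under eq_bigr do rewrite exchange_big /=.
rewrite exchange_big; apply: eq_bigr => s _ /=.
under eq_bigr do rewrite exchange_big /=.
rewrite exchange_big; apply: eq_bigr => t _ /=.
rewrite !mxE exchange_big /= scaler_suml; apply: eq_bigr => b _.
rewrite !mxE mulr_suml scaler_suml; apply: eq_bigr => a _.
by rewrite !mxE.
Qed.

Lemma jet_eq0 d (R : P1 k) s : (d < s)%N -> jet d R s = 0.
Proof.
move=> lt_ds; apply/colP => n; rewrite !mxE; have := ltn_ord n.
case: R => [a|] /= lt_n; first by rewrite bin_small ?mulr0n //; lia.
by case: eqP => // E; lia.
Qed.

Lemma ideal_pow_form i j (P : pt k) m (A : 'M[k]_(i.+1, j.+1)) :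
  ideal_pow (pt_ideal P) m (form_of_mx A) <->
  forall s t, (s + t < m)%N -> (jet i P.1 s)^T *m A *m jet j P.2 t = 0.
Proof.
rewrite ideal_pow_order swap_form; split=> [ge_m s t lt_m | vA u].
  (* Orders beyond the bidegree match no monomial, but there the jets are zero. *)
  have [lt_is | le_si] := ltnP i s; first by rewrite (jet_eq0 _ lt_is) trmx0 !mul0mx.
  have [lt_jt | le_tj] := ltnP j t; first by rewrite (jet_eq0 _ lt_jt) mulmx0.
  rewrite -ltnS in le_si; rewrite -ltnS in le_tj.
  have := mcoeff_form (\matrix_(s, t) ((jet i P.1 s)^T *m A *m jet j P.2 t) 0 0)
     (Ordinal le_si) (Ordinal le_tj).
  rewrite memN_msupp_eq0 => [|]; last first.
    by apply/negP => /ge_m; have [_ -> _ ->] := bimonE i j s t; lia.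
  by rewrite mxE /= => E; apply/matrixP => a b; rewrite !ord1 -E mxE.
move=> Bu; have [s [t def_u]] := msupp_form Bu; move: Bu; rewrite {}def_u.
have [_ -> _ ->] := bimonE i j s t.
by rewrite mcoeff_msupp mcoeff_form mxE leqNgt; apply: contra => /vA ->; rewrite mxE.
Qed.

(** * From the ideal of the scheme to vanishing conditions *)

Lemma mult_mem (Z : fatscheme k) e :
  uniq [seq e.1 | e <- Z] -> e \in Z -> mult Z e.1 = e.2.
Proof.
rewrite /mult; elim: Z => //= e' Z IH /andP [nZe' uZ].
rewrite inE big_cons => /predU1P [-> | Ze].
  rewrite eqxx big1_seq ?addn0 // => e'' /andP [/eqP e''e' Ze''].
  by case/mapP: nZe'; exists e''.
case: eqP => [ee'|_]; last exact: IH.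
by case/mapP: nZe'; exists e.
Qed.

Lemma mult_gt0 (Z : fatscheme k) P :
  (0 < mult Z P)%N -> exists2 e, e \in Z & e.1 = P.
Proof.
rewrite lt0n => nz; have /hasP [e Ze /eqP eP] : has (fun e => e.1 == P) Z.
  by apply: contraNT nz => /hasPn nZ; rewrite /mult big1_seq // => e /andP [eP /nZ]; rewrite eP.
by exists e.
Qed.

(** Points of the grid outside the support have multiplicity 0 and impose no condition. *)
Lemma IZ_vanishing i j (Z : fatscheme k) (A : 'M[k]_(i.+1, j.+1)) :
  uniq [seq e.1 | e <- Z] ->
  IZ Z (form_of_mx A) <->
  vanishing (proj1s Z) (proj2s Z) (fun R Q => mult Z (R, Q)) A.
Proof.
move=> uZ; split=> [IA R Q s t _ _ lt_st | vA e Ze].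
  have [|e Ze eRQ] := @mult_gt0 Z (R, Q); first exact: leq_ltn_trans lt_st.
  move: lt_st; rewrite -eRQ mult_mem // => lt_st.
  by have /ideal_pow_form/(_ s t lt_st) := IA e Ze; rewrite eRQ.
apply/ideal_pow_form => s t lt_st; apply: vA.
- by rewrite mem_undup; apply/mapP; exists e.
- by rewrite mem_undup; apply/mapP; exists e.
- by rewrite -surjective_pairing mult_mem.
Qed.

Lemma hilb_dim_vanishing i j n (Z : fatscheme k) : uniq [seq e.1 | e <- Z] ->
  quotient_dim (@vanishing k i j (proj1s Z) (proj2s Z) (fun R Q => mult Z (R, Q))) n ->
  hilb_dim Z i j n.
Proof.
move=> uZ [p [free_p span_p]]; exists (fun l => form_of_mx (p l)); split.
- by move=> l; apply: bihom_form.
- by move=> c; rewrite -form_of_mx_sum => /IZ_vanishing-/(_ uZ)/free_p.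
- move=> q /form_of_mxK ->; set A := \matrix_(_, _) _.
  have [c vc] := span_p A; exists c.
  by rewrite -form_of_mx_sum -form_of_mxB; apply/IZ_vanishing.
Qed.

End FatPoints.

(** * Counting entries of the tuples, and the conclusion *)

Lemma sum_nge (s : seq nat) n :
  \sum_(1 <= kk < n.+1) nge s kk = \sum_(a <- s) minn n a.
Proof.
(* Double counting: an entry [a] is counted once for each [kk] from 1 to [minn n a]. *)
rewrite (eq_bigr (fun kk => \sum_(a <- s) (kk <= a))) => [|kk _]; last first.
  by rewrite /nge -sum1_count big_mkcond; apply: eq_bigr => a _; case: leqP.
rewrite exchange_big; apply: eq_bigr => a _ /=.
elim: n => [|n IH]; first by rewrite big_geq // min0n.
by rewrite big_nat_recr //= IH; lia.
Qed.

Lemma sum_sort_flatten (T : Type) (r : seq T) (l : T -> nat) (a : T -> nat -> nat) F :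
  \sum_(x <- sort geq (flatten [seq [seq a R s | s <- iota 0 (l R)] | R <- r])) F x
  = \sum_(R <- r) \sum_(s <- iota 0 (l R)) F (a R s).
Proof.
rewrite (perm_big _ (permEl (perm_sort _ _))) big_flatten big_map.
by apply: eq_bigr => R _; rewrite big_map.
Qed.

Lemma size_sort_flatten (T : Type) (r : seq T) (l : T -> nat) (a : T -> nat -> nat) :
  size (sort geq (flatten [seq [seq a R s | s <- iota 0 (l R)] | R <- r]))
  = \sum_(R <- r) l R.
Proof.
rewrite size_sort size_flatten /shape sumnE -map_comp big_map; apply: eq_bigr => R _.
by rewrite /= size_map size_iota.
Qed.

Theorem theorem3p2 (k : closedFieldType) (Z : fatscheme k)
  (Zuniq : uniq [seq e.1 | e <- Z])
  (Zpos : forall e, e \in Z -> (0 < e.2)%N) :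
  (forall j i : nat, ((size (alphaZ Z)).-1 <= i)%N ->
     hilb_dim Z i j (\sum_(1 <= kk < j.+2) nge (alphaZ Z) kk)%N) /\
  (forall i j : nat, ((size (betaZ Z)).-1 <= j)%N ->
     hilb_dim Z i j (\sum_(1 <= kk < i.+2) nge (betaZ Z) kk)%N).
Proof.
have [u1 u2] : uniq (proj1s Z) /\ uniq (proj2s Z) by rewrite !undup_uniq.
(* The bound on the predecessor of the size becomes, through [leqSpred], the bound by [i.+1] or
   [j.+1] on the number of conditions; this covers the empty tuple too. *)
split=> [j i | i j]; rewrite size_sort_flatten -ltnS => le_size;
  apply: hilb_dim_vanishing => //; rewrite sum_nge sum_sort_flatten.
  apply: quotient_dim_vanishing => // [R Q _ Q2|]; last exact: leq_trans (leqSpred _) le_size.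
  exact: (leq_bigmax_seq (P := xpredT) (F := fun Q => mult Z (R, Q))).
(* The second half is the first one applied to the transposed matrices. *)
apply: (quotient_dim_iff (@vanishing_tr _ _ _ _ _ _)).
apply: (quotient_dim_tr (W := vanishing _ _ (fun Q R => mult Z (R, Q)))).
apply: quotient_dim_vanishing => // [Q R _ R1|]; last exact: leq_trans (leqSpred _) le_size.
exact: (leq_bigmax_seq (P := xpredT) (F := fun R => mult Z (R, Q))).
Qed.
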